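(* Let $K\subseteq\mathbb{R}^n$ be a closed proper convex cone with nonempty interior, $g:[0,\pi]\to\mathbb{R}$ continuous and strictly increasing, and $\psi(w)=\int_{K_1} g(\rho(w,y))\,d\sigma(y)$ for $w\in\mathcal{S}^{n-1}$. Then every local minimum point of $\psi$ on $\mathcal{S}^{n-1}$ lies in $\hat K\cup(-\hat K)$, and every global minimum point of $\psi$ lies in $K\cap\hat K$.
   Context: $\mathcal{S}^{n-1}$ is the Euclidean unit sphere in $\mathbb{R}^n$, $\sigma$ the normalized uniform measure on it, $\rho(w,y)=\arccos\langle w,y\rangle$ the geodesic distance. For $A\subseteq\mathbb{R}^n$, $A_1=A\cap\mathcal{S}^{n-1}$ and $\hat A=\{x\in\mathbb{R}^n:\langle x,v\rangle\ge 0\ \forall v\in A\}$. A convex cone is proper if it is contained in some closed halfspace through the origin. *)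

(* Defs.v *)
From HB Require Import structures.
From mathcomp Require Import all_boot all_order all_algebra.
From mathcomp Require Import all_classical all_reals all_analysis.
Set Implicit Arguments. Unset Strict Implicit. Unset Printing Implicit Defensive.
Import Order.TTheory GRing.Theory Num.Theory.
Import numFieldNormedType.Exports.
Local Open Scope classical_set_scope.
Local Open Scope ring_scope.

Definition dot (R : realType) (n : nat) (u v : 'rV[R]_n) : R :=
  \sum_(i < n) u 0 i * v 0 i.

Definition sphere (R : realType) (n : nat) : set 'rV[R]_n :=
  [set x | dot x x = 1].

Definition rho (R : realType) (n : nat) (w y : 'rV[R]_n) : R := acos (dot w y).

Definition dual_cone (R : realType) (n : nat) (A : set 'rV[R]_n) : set 'rV[R]_n :=
  [set x | forall v, A v -> 0 <= dot x v].

Definition neg_set (R : realType) (n : nat) (A : set 'rV[R]_n) : set 'rV[R]_n :=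
  [set x | A (- x)].

Definition convex_cone (R : realType) (n : nat) (K : set 'rV[R]_n) : Prop :=
  (forall x y (t : R), K x -> K y -> 0 <= t <= 1 -> K (t *: x + (1 - t) *: y)) /\
  (forall (t : R) x, 0 <= t -> K x -> K (t *: x)).

Definition proper_cone (R : realType) (n : nat) (K : set 'rV[R]_n) : Prop :=
  exists v : 'rV[R]_n, v != 0 /\ forall x, K x -> 0 <= dot v x.

Definition borelRn (R : realType) (n : nat) := g_sigma_algebraType (@open 'rV[R]_n).

(* sigma is the normalized uniform measure on S^{n-1}: a Borel probability
   measure on R^n concentrated on the sphere and invariant under all
   orthogonal transformations x |-> x M (M M^T = 1). *)
Definition uniform_sphere_measure (R : realType) (n : nat)
    (mu : {measure set (borelRn R n) -> \bar R}) : Prop :=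
  mu (sphere (R:=R) (n:=n)) = 1%E /\
  mu (~` sphere (R:=R) (n:=n)) = 0%E /\
  forall (M : 'M[R]_n), M *m M^T = 1%:M ->
    forall A : set (borelRn R n), measurable A ->
      mu ((fun x : 'rV[R]_n => x *m M) @^-1` A) = mu A.

Definition psi (R : realType) (n : nat) (mu : {measure set (borelRn R n) -> \bar R})
    (g : R -> R) (K : set 'rV[R]_n) (w : 'rV[R]_n) : R :=
  fine (\int[mu]_(y in (K `&` sphere (R:=R) (n:=n) : set (borelRn R n)))
          (g (rho w y))%:E)%E.

Definition local_min_on_sphere (R : realType) (n : nat) (f : 'rV[R]_n -> R)
    (w : 'rV[R]_n) : Prop :=
  sphere w /\ \forall v \near w, sphere v -> f w <= f v.

Definition global_min_on_sphere (R : realType) (n : nat) (f : 'rV[R]_n -> R)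
    (w : 'rV[R]_n) : Prop :=
  sphere w /\ forall v, sphere v -> f w <= f v.

(* Main.v *)
(* Let [tau] be the reflection in the hyperplane orthogonal to [v], and let
   [<v,w>] be negative. If [tau] sends every point of [K] on the side of [w]
   back into [K], then [psi (tau w) < psi w], as soon as some interior point of
   [K] is sent outside of [K]: the points of [K1] whose mirror image is in [K]
   contribute equally to both values, and the others are on the far side from
   [w], hence closer to [tau w].

   If [w] is neither in the dual cone nor in its opposite, there is an interior
   point [v0] of [K] orthogonal to [w]; for small [e > 0] the vector
   [v = v0 - e w] is still in [K], so that [y] in [K] with [<v,y> < 0] is moved
   by a positive multiple of [v] and stays in [K], and [tau w] tends to [w] with
   [e]: [w] is not a local minimum. If [w] is not in [K], the hyperplane
   separating [w] from [K] shows that [w] is not a global minimum. *)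
Require Import Defs.
From HB Require Import structures.
From mathcomp Require Import all_boot all_order all_algebra.
From mathcomp Require Import all_classical all_reals all_analysis.
From mathcomp Require Import measurable_realfun ring lra.
Set Implicit Arguments. Unset Strict Implicit. Unset Printing Implicit Defensive.
Import Order.TTheory GRing.Theory Num.Theory.
Import numFieldNormedType.Exports.
Local Open Scope classical_set_scope.
Local Open Scope ring_scope.

(** * Dot product, reflections and compactness of the sphere *)

Section DotProduct.
Variables (R : realType) (n : nat).
Implicit Types (u v w x y z : 'rV[R]_n) (t : R) (K U A : set 'rV[R]_n).

Lemma dotE u v : dot u v = (u *m v^T) 0 0.
Proof. by rewrite mxE; apply: eq_bigr => i _; rewrite mxE. Qed.

Lemma dotC u v : dot u v = dot v u.
Proof. by apply: eq_bigr => i _; rewrite mulrC. Qed.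

Lemma dotDr u v w : dot u (v + w) = dot u v + dot u w.
Proof. by rewrite !dotE linearD mulmxDr mxE. Qed.

Lemma dotZr t u v : dot u (t *: v) = t * dot u v.
Proof. by rewrite !dotE linearZ -scalemxAr mxE. Qed.

Lemma dotDl u v w : dot (v + w) u = dot v u + dot w u.
Proof. by rewrite -!(dotC u) dotDr. Qed.

Lemma dotZl t u v : dot (t *: v) u = t * dot v u.
Proof. by rewrite -!(dotC u) dotZr. Qed.

Lemma dotNr u v : dot u (- v) = - dot u v.
Proof. by rewrite -scaleN1r dotZr mulN1r. Qed.

Lemma dotNl u v : dot (- v) u = - dot v u.
Proof. by rewrite -!(dotC u) dotNr. Qed.

Lemma dot0r u : dot u 0 = 0.
Proof. by rewrite dotE trmx0 mulmx0 mxE. Qed.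

Definition dot_linear := (dotDl, dotDr, dotZl, dotZr, dotNl, dotNr).

Lemma dot_sqr_ge0 v : 0 <= dot v v.
Proof. by apply: sumr_ge0 => i _; rewrite -expr2 sqr_ge0. Qed.

Lemma dot_sqr_eq0 v : (dot v v == 0) = (v == 0).
Proof.
apply/idP/eqP => [|->]; last by rewrite /dot big1// => i _; rewrite mxE mul0r.
rewrite psumr_eq0 => [/allP v0|i _]; last by rewrite -expr2 sqr_ge0.
apply/rowP => i; have := v0 i (mem_index_enum _).
by rewrite -expr2 sqrf_eq0 mxE => /eqP.
Qed.

Lemma dot_sqr_gt0 v : (0 < dot v v) = (v != 0).
Proof. by rewrite lt0r dot_sqr_eq0 dot_sqr_ge0 andbT. Qed.

Lemma dot_sqr_line u v t :
  dot (u + t *: v) (u + t *: v) = dot u u + 2 * t * dot u v + t ^+ 2 * dot v v.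
Proof. by rewrite !dot_linear (dotC v u); ring. Qed.

Lemma coord_sqr_le_dot v i : v 0 i ^+ 2 <= dot v v.
Proof.
rewrite /dot (bigD1 i)//= -expr2 lerDl.
by apply: sumr_ge0 => j _; rewrite -expr2 sqr_ge0.
Qed.

Lemma sphere_dot_itv w y : sphere w -> sphere y -> -1 <= dot w y <= 1.
Proof.
rewrite /sphere/= => w1 y1.
have := dot_sqr_ge0 (w - y); have := dot_sqr_ge0 (w + y).
rewrite !dot_linear (dotC y w) w1 y1 => ? ?.
by apply/andP; split; lra.
Qed.

Definition reflection v y := y - (2 * dot v y / dot v v) *: v.

Lemma dot_reflection v x y : dot (reflection v x) y = dot x (reflection v y).
Proof. rewrite /reflection !dot_linear (dotC x v); ring. Qed.

Lemma reflectionK v : v != 0 -> involutive (reflection v).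
Proof.
rewrite -dot_sqr_eq0 => v0 y; rewrite /reflection !dot_linear.
rewrite -addrA -opprD -scalerDl [X in X *: _](_ : _ = 0) ?scale0r ?subr0//.
by field.
Qed.

Lemma dot_reflectionl v y : v != 0 -> dot v (reflection v y) = - dot v y.
Proof. by rewrite -dot_sqr_eq0 /reflection !dot_linear => v0; field. Qed.

Lemma reflection_self v : v != 0 -> reflection v v = - v.
Proof.
rewrite -dot_sqr_eq0 => v0; rewrite /reflection mulfK// scaler_nat mulr2n.
by rewrite opprD addNKr.
Qed.

Lemma reflection_sphere v y : v != 0 -> sphere y -> sphere (reflection v y).
Proof. by move=> v0; rewrite /sphere/= dot_reflection reflectionK. Qed.

(** For unit vectors [2 * dot (x - y) y = - dot (x - y) (x - y)], so the coefficient of [x - y] is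
    [-1]. Hence reflections act transitively on the sphere. *)
Lemma reflection_sub x y : x != y -> sphere x -> sphere y ->
  reflection (x - y) y = x.
Proof.
rewrite -subr_eq0 -dot_sqr_eq0 /sphere/= /reflection !dot_linear (dotC y x).
move=> + x1 y1; rewrite x1 y1 => xy; rewrite [X in X *: _](_ : _ = -1).
  by rewrite scaleN1r opprK addrC subrK.
by field; apply: contra_neq xy => xy; rewrite -[RHS]xy; ring.
Qed.

(** The matrix form, acting on row vectors from the right as in [uniform_sphere_measure]. *)
Definition reflection_mx v : 'M[R]_n := 1%:M - (2 / dot v v) *: (v^T *m v).

Lemma mul_reflection_mx v y : y *m reflection_mx v = reflection v y.
Proof.
rewrite mulmxBr mulmx1 -scalemxAr mulmxA [y *m v^T]mx11_scalar -dotE.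
by rewrite mul_scalar_mx scalerA /reflection dotC mulrAC.
Qed.

(** The matrix is symmetric and acts as an involution. *)
Lemma reflection_mx_orthogonal v : v != 0 ->
  reflection_mx v *m (reflection_mx v)^T = 1%:M.
Proof.
move=> v0; have -> : (reflection_mx v)^T = reflection_mx v.
  by rewrite /reflection_mx linearB linearZ/= trmx_mul trmxK trmx1.
apply/row_matrixP => i.
by rewrite !rowE mulmxA !mul_reflection_mx reflectionK// mulmx1.
Qed.

Lemma dot_continuous u : continuous (dot u).
Proof.
apply: continuous_big => [|i _ x]; first exact: add_continuous.
by apply: continuousM; [exact: cst_continuous|exact: coord_continuous].
Qed.

Lemma dot_sqr_continuous : continuous (fun x => dot x x).
Proof.
apply: continuous_big => [|i _ x]; first exact: add_continuous.
by apply: continuousM; exact: coord_continuous.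
Qed.

Lemma reflection_continuous v : continuous (reflection v).
Proof.
move=> x; apply: (@continuousB _ _ _ idfun) ; first exact: cvg_id.
apply: continuousZr_tmp; apply: continuousM; last exact: cst_continuous.
by apply: continuousM; [exact: cst_continuous|exact: dot_continuous].
Qed.

Lemma sphere_closed : closed (sphere (R:=R) (n:=n)).
Proof.
apply: (@preimage_closed _ _ (fun x => dot x x) [set 1]); last exact: closed_eq.
by move=> x _; exact: dot_sqr_continuous.
Qed.

Lemma closed_dot_bounded_compact A t : 0 <= t -> closed A ->
  (forall x, A x -> dot x x <= t ^+ 2) -> compact A.
Proof.
move=> t0 cA At.
have cB : compact [set v : 'rV[R]_n | forall i, `[- t, t]%classic (v 0 i)].
  by apply: (@rV_compact _ _ (fun=> `[- t, t]%classic)) => i; exact: segment_compact.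
apply: (subclosed_compact cA cB) => x Ax i /=; rewrite in_itv/= -ler_norml.
rewrite -(ler_pXn2r (n := 2))// ?nnegrE// real_normK ?num_real//.
exact: le_trans (coord_sqr_le_dot x i) (At _ Ax).
Qed.

Lemma sphere_compact : compact (sphere (R:=R) (n:=n)).
Proof.
apply: (@closed_dot_bounded_compact _ 1) => //; first exact: sphere_closed.
by move=> x; rewrite /sphere/= => ->; rewrite expr1n.
Qed.

End DotProduct.

(** If the integrals were equal, the positive function [f2 - f1] would have integral zero, hence
    vanish almost everywhere on [D], and [D] would be negligible. *)
Lemma lt_Rintegral (d : measure_display) (T : measurableType d) (R : realType)
    (mu : {measure set T -> \bar R}) (D : set T) (f1 f2 : T -> R) :
  measurable D -> mu.-integrable D (EFin \o f1) ->
  mu.-integrable D (EFin \o f2) -> (forall x, D x -> f1 x < f2 x) ->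
  (0 < mu D)%E -> \int[mu]_(x in D) f1 x < \int[mu]_(x in D) f2 x.
Proof.
move=> mD if1 if2 f12 muD; rewrite lt_neqAle le_Rintegral ?andbT//; last first.
  by move=> x Dx; exact/ltW/f12.
apply/eqP => eq12; move: muD; rewrite lt_neqAle eq_sym => /andP[/eqP + _]; apply.
have if21 : mu.-integrable D (EFin \o (f2 \- f1)%R) by exact: (integrableB mD if2 if1).
have int0 : (\int[mu]_(x in D) `|(EFin \o (f2 \- f1)%R) x|)%E = 0%E.
  under eq_integral => x /set_mem Dx.
    rewrite /= gtr0_norm ?subr_gt0; last exact: f12.
    over.
  rewrite -[LHS]fineK; last exact: (integrable_fin_num mD if21).
  by have := RintegralB mD if2 if1; rewrite eq12 subrr /Rintegral => ->.
have := (ae_eq_integral_abs mu mD (measurable_int _ if21)).1 int0.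
move=> [N [mN N0 sub]]; apply: (subset_measure0 mD mN _ N0).
move=> x Dx; apply: sub => /= /(_ Dx) [] /eqP.
by rewrite subr_eq0 gt_eqF// f12.
Qed.

(** * Borel sets and reflection invariance of the uniform measure *)

Section UniformMeasure.
Variables (R : realType) (n : nat).
Implicit Types (v x : 'rV[R]_n) (U : set 'rV[R]_n).

Lemma open_borel (U : set (borelRn R n)) :
  open (U : set 'rV[R]_n) -> measurable U.
Proof. exact: sub_sigma_algebra. Qed.

Lemma closed_borel (U : set (borelRn R n)) :
  closed (U : set 'rV[R]_n) -> measurable U.
Proof.
move=> cU; rewrite -[U]setCK; apply: measurableC; apply: open_borel.
exact: closed_openC.
Qed.

Lemma continuous_borel (f : borelRn R n -> borelRn R n) :
  continuous (f : 'rV[R]_n -> 'rV[R]_n) -> measurable_fun setT f.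
Proof.
move=> cf.
apply: (@measurability _ _ (borelRn R n) (borelRn R n) setT f (@open 'rV[R]_n)).
  by [].
move=> _ [U oU <-]; rewrite setTI; apply: open_borel.
by move/continuousP : cf; exact.
Qed.

Lemma continuous_borel_real (f : borelRn R n -> R) :
  continuous (f : 'rV[R]_n -> R) -> measurable_fun setT f.
Proof.
move=> cf; apply: (measurability _ (RGenOpens.measurableE R)).
move=> _ [_ [a [b ->] <-]]; rewrite setTI; apply: open_borel.
by move/continuousP : cf; apply; exact: interval_open.
Qed.

Lemma sphere_borel : measurable (sphere (R:=R) (n:=n) : set (borelRn R n)).
Proof. by apply: closed_borel; exact: sphere_closed. Qed.

Variable mu : {measure set (borelRn R n) -> \bar R}.
Hypothesis mu_uniform : uniform_sphere_measure mu.

Lemma uniform_sphere_setT : mu setT = 1%E.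
Proof.
have mS := sphere_borel; have [S1 [S0 _]] := mu_uniform.
rewrite -(setUv (sphere (R:=R) (n:=n) : set (borelRn R n))) measureU ?setICr//.
  transitivity (1 + 0 : \bar R)%E; last by rewrite adde0.
  by congr (_ + _)%E; [exact: S1|exact: S0].
exact: measurableC.
Qed.

Lemma uniform_sphere_fin_num A : measurable A -> (mu A < +oo)%E.
Proof.
move=> mA; apply: (@le_lt_trans _ _ (mu setT)).
  by apply: le_measure; rewrite ?inE.
by rewrite uniform_sphere_setT ltry.
Qed.

Lemma measure_reflection v (A : set (borelRn R n)) :
  v != 0 -> measurable A -> mu (reflection v @^-1` A) = mu A.
Proof.
move=> v0 mA; have [_ [_ /(_ _ (reflection_mx_orthogonal v0) _ mA) <-]] := mu_uniform.
by congr (mu _); apply/seteqP; split=> x /=; rewrite mul_reflection_mx.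
Qed.

(* Reflections act transitively on the sphere, so the sphere is covered by the
   reflected images of [U], finitely many by compactness. *)
Lemma uniform_sphere_open_gt0 (U : set (borelRn R n)) x :
  open (U : set 'rV[R]_n) -> U x -> sphere x -> (0 < mu U)%E.
Proof.
move=> oU Ux Sx; rewrite lt0e measure_ge0 andbT; apply/eqP => U0.
(* [measure_reflection] asks for a nonzero vector, hence the separate case [x = y]. *)
pose f (y : 'rV[R]_n) : set (borelRn R n) :=
  if x == y then U else reflection (x - y) @^-1` U.
have of_ y : open (f y : set 'rV[R]_n).
  rewrite /f; case: ifP => // _; apply: open_comp oU => z _.
  exact: reflection_continuous.
have f0 y : mu (f y) = 0%E.
  rewrite /f; case: ifPn => // xy; rewrite measure_reflection ?subr_eq0//.
  exact: open_borel.
have := @sphere_compact R n; rewrite compact_cover.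
move=> /(_ _ (sphere (R:=R) (n:=n)) f) [//||D _ SD].
  move=> y Sy; exists y => //; rewrite /f; case: ifPn => [/eqP <-//|xy] /=.
  by rewrite reflection_sub.
have : mu.-negligible (sphere (R:=R) (n:=n) : set (borelRn R n)).
  apply: (@negligibleS _ (borelRn R n) R mu _ _ SD); rewrite /cover bigcup_seq.
  apply: big_ind => [|A B|i _]; [exact: negligible_set0|exact: negligibleU|].
  by apply/negligibleP; [apply: open_borel; exact: of_|exact: f0].
move=> /negligibleP-/(_ sphere_borel) S0.
have [S1 _] := mu_uniform.
by move/eqP: (etrans (esym S1) S0); rewrite onee_eq0.
Qed.

Lemma bounded_borel_integrable (A : set (borelRn R n)) (f : borelRn R n -> R)
    (t : R) :
  measurable A -> measurable_fun setT f -> (forall y, `|f y| <= t) ->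
  mu.-integrable A (EFin \o f).
Proof.
move=> mA mf ft; apply: measurable_bounded_integrable => //.
- exact: uniform_sphere_fin_num.
- exact: measurable_funS mf.
- by exists t; split; [exact: num_real|move=> s ts y _; exact: le_trans (ltW ts)].
Qed.

(** Change of variables: [mu] is its own pushforward under the reflection, and [E] its own
    preimage. *)
Lemma Rintegral_reflection v (E : set (borelRn R n)) (f : borelRn R n -> R) :
  v != 0 -> measurable E -> reflection v @^-1` E = E ->
  measurable_fun setT f -> mu.-integrable E (EFin \o (f \o reflection v)) ->
  \int[mu]_(y in E) f (reflection v y) = \int[mu]_(y in E) f y.
Proof.
move=> v0 mE EE mf fi.
have mr : measurable_fun setT (reflection v : borelRn R n -> borelRn R n).
  by apply: continuous_borel; exact: reflection_continuous.
rewrite /Rintegral; congr fine.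
have := integral_pushforward mr (D := E) (f := EFin \o f) (mu := mu).
rewrite EE => <-//; last exact/measurable_EFinP.
by apply: eq_measure_integral => A mA _; exact: measure_reflection.
Qed.

End UniformMeasure.

(** * The potential as a function of the dot product *)

Section SphericalPotential.
Variables (R : realType) (g : R -> R).
Hypothesis g_incr : {in `[0, pi] &, forall x y, x < y -> g x < g y}.

(* The clamping to [-1, 1] makes this function monotone and bounded on the whole
   line, hence measurable. *)
Definition clamped_potential (t : R) := g (acos (Num.max (-1) (Num.min t 1))).

Lemma clamped_potentialE t : -1 <= t <= 1 -> clamped_potential t = g (acos t).
Proof.
by case/andP => t1 t2; rewrite /clamped_potential (min_idPl t2) (max_idPr t1).
Qed.

Lemma clamp_itv (t : R) : -1 <= Num.max (-1) (Num.min t 1) <= 1.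
Proof.
by rewrite le_max lexx/= ge_max ge_min lexx orbT andbT; lra.
Qed.

Lemma acos_itv (t : R) : -1 <= t <= 1 -> acos t \in `[0, pi].
Proof. by move=> t1; rewrite in_itv/= acos_ge0// acos_lepi. Qed.

Lemma lt_acos (s t : R) : -1 <= s <= 1 -> -1 <= t <= 1 -> s < t ->
  acos t < acos s.
Proof.
move=> s1 t1 st; rewrite -ltr_cos ?acos_itv// !acosK//.
Qed.

Lemma lt_clamped_potential s t : -1 <= s <= 1 -> -1 <= t <= 1 -> s < t ->
  clamped_potential t < clamped_potential s.
Proof.
move=> s1 t1 st; rewrite !clamped_potentialE//.
by apply: g_incr; rewrite ?acos_itv// lt_acos.
Qed.

Lemma clamped_potential_nonincreasing s t : s <= t ->
  clamped_potential t <= clamped_potential s.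
Proof.
move=> st; rewrite /clamped_potential.
have := clamp_itv s; have := clamp_itv t.
have : Num.max (-1) (Num.min s 1) <= Num.max (-1) (Num.min t 1).
  by rewrite le_max2// le_min2.
move: (Num.max _ (Num.min s 1)) (Num.max _ (Num.min t 1)) => a b.
rewrite le_eqVlt => /predU1P[->//|ab b1 a1].
by apply/ltW/g_incr; rewrite ?acos_itv// lt_acos.
Qed.

(** By monotonicity the values lie between those at [1] and at [-1]. *)
Lemma clamped_potential_bounded t : `|clamped_potential t| <=
  `|clamped_potential (-1)| + `|clamped_potential 1|.
Proof.
have Em : clamped_potential (Num.max (-1) (Num.min t 1)) = clamped_potential t.
  by have := clamp_itv t => /clamped_potentialE.
have /andP[t1 t2] := clamp_itv t; move: t1 t2.
move=> /clamped_potential_nonincreasing + /clamped_potential_nonincreasing.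
rewrite Em => h1 h2; rewrite ler_norml.
have a0 := ler_norm (clamped_potential (-1)).
have := ler_norm (- clamped_potential 1); rewrite normrN => b0.
have a1 := normr_ge0 (clamped_potential (-1)).
have b1 := normr_ge0 (clamped_potential 1).
by apply/andP; split; lra.
Qed.

End SphericalPotential.

(** * Convex cones: interior points and separation *)

Section Cones.
Variables (R : realType) (n : nat) (K : set 'rV[R]_n).
Implicit Types (q v w x y z : 'rV[R]_n) (t : R).

Lemma subr_continuous w : continuous (fun y => y - w).
Proof.
move=> y; apply: (@continuousB _ _ _ idfun); first exact: cvg_id.
exact: cst_continuous.
Qed.

Lemma cvg_line_at_right x y : (x + e *: y) @[e --> (0 : R)^'+] --> x.
Proof.
apply: cvg_at_right_filter; rewrite -[X in _ --> X]addr0 -(scale0r y).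
by apply: cvgD; [exact: cvg_cst|apply: cvgZr_tmp; exact: cvg_id].
Qed.

(** A small move from [z] along [- q] stays in [K] and strictly decreases the product with [q],
    which is still nonnegative afterwards. *)
Lemma interior_dual_gt0 q z : q != 0 -> (forall x, K x -> 0 <= dot q x) ->
  K° z -> 0 < dot q z.
Proof.
move=> q0 Kq Kz.
have [e [e0 Ke]] : exists e : R, 0 < e /\ K (z + e *: - q).
  near (0 : R)^'+ => e; exists e; split; near: e; first exact: nbhs_right_gt.
  exact: (@cvg_line_at_right z (- q) K Kz).
have := Kq _ Ke; rewrite !dot_linear mulrN subr_ge0; apply: lt_le_trans.
by rewrite mulr_gt0// dot_sqr_gt0.
Unshelve. all: by end_near. Qed.

Hypothesis K_cone : convex_cone K.

Lemma coneD x y : K x -> K y -> K (x + y).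
Proof.
move=> Kx Ky; have [cK sK] := K_cone.
have -> : x + y = 2 *: (2^-1 *: x + (1 - 2^-1) *: y).
  have h1 : 2 * 2^-1 = 1 :> R by field.
  have h2 : 2 * (1 - 2^-1) = 1 :> R by field.
  by rewrite scalerDr !scalerA h1 h2 !scale1r.
by apply: sK => //; apply: cK => //; lra.
Qed.

Lemma coneZ t x : 0 <= t -> K x -> K (t *: x).
Proof. by have [_ sK] := K_cone; exact: sK. Qed.

(** The preimage of the interior is open and contained in [K]. Below, [f] is the inverse of a
    translation or of a homothety that preserves [K]. *)
Lemma interior_preimage (f : 'rV[R]_n -> 'rV[R]_n) x : continuous f ->
  f @^-1` K `<=` K -> K° (f x) -> K° x.
Proof.
move=> cf fK Kfx; have of_ : open (f @^-1` K°).
  by apply: open_comp; [move=> y _; exact: cf|exact: open_interior].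
suff : f @^-1` K° `<=` K° by apply.
by rewrite -open_subsetE// => y /= /interior_subset; exact: fK.
Qed.

Lemma cone_interiorD x z : K x -> K° z -> K° (x + z).
Proof.
move=> Kx Kz; apply: (interior_preimage (@subr_continuous x)).
  by move=> y /= Ky; rewrite -(subrK x y); exact: coneD.
by rewrite addrAC subrr add0r.
Qed.

Lemma cone_interiorZ t z : 0 < t -> K° z -> K° (t *: z).
Proof.
move=> t0 Kz; have t0' := lt0r_neq0 t0.
apply: (@interior_preimage (fun y => t^-1 *: y)); last by rewrite scalerK.
  by move=> y; apply: (@continuousZl_tmp _ _ _ idfun); exact: cvg_id.
by move=> y /= Ky; rewrite -(scalerKV t0' y); apply: coneZ => //; exact: ltW.
Qed.

(* [v] is the difference between the metric projection of [w] on [K] and [w]. *)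
Lemma cone_separation w : closed K -> K !=set0 -> ~ K w ->
  exists v, [/\ v != 0, dot v w < 0 & forall x, K x -> 0 <= dot v x].
Proof.
move=> cK [x0 Kx0] nKw.
have K0 : K 0 by rewrite -(scale0r x0); exact: coneZ.
pose f y := dot (y - w) (y - w).
have cf : continuous f.
  move=> y; apply: (@continuous_comp _ _ _ (fun y => y - w) (fun y => dot y y)).
    exact: subr_continuous.
  exact: dot_sqr_continuous.
(* As [f 0 = dot w w], cutting at this level keeps the minimum of [f] over [K] and makes the domain
   compact. *)
pose B := K `&` [set y | f y <= dot w w].
have B0 : B 0 by split => //=; rewrite /f sub0r !dot_linear opprK.
have cB : compact B.
  have w0 := dot_sqr_ge0 w.
  (* The inequalities below give [dot y y <= 4 * dot w w]; the square of this radius exceeds that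
     bound, and no square root is needed. *)
  apply: (@closed_dot_bounded_compact _ _ _ (2 * (1 + dot w w))).
  - lra.
  - apply: closedI => //.
    apply: (@preimage_closed _ _ f [set s | s <= dot w w]); last exact: closed_le.
    by move=> y _; exact: cf.
  - move=> y [_ /=]; rewrite /f => fy; have := dot_sqr_ge0 (y - 2 *: w).
    move: fy; rewrite !dot_linear (dotC w y); nra.
have [||p /set_mem [Kp fp] pmin] := @compact_EVT_min _ R f B _ cB.
- by exists 0.
- exact: continuous_subspaceT.
have {}pmin y : K y -> f p <= f y.
  move=> Ky; have [fy|fy] := leP (f y) (dot w w).
    by apply: pmin; rewrite inE.
  exact: le_trans fp (ltW fy).
have v0 : p - w != 0 by rewrite subr_eq0; apply: contra_notN nKw => /eqP <-.
have dual x : K x -> 0 <= dot (p - w) x.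
  move=> Kx; rewrite leNgt; apply/negP => px.
  have x0' : 0 < dot x x.
    rewrite dot_sqr_gt0; apply: contraTneq px => ->.
    by rewrite dot0r ltxx.
  (* The minimizer of [f (p + s *: x)], a quadratic polynomial in [s]. *)
  pose s := - dot (p - w) x / dot x x.
  have s0 : 0 < s by rewrite divr_gt0// oppr_gt0.
  have := pmin _ (coneD Kp (coneZ (ltW s0) Kx)).
  rewrite /f addrAC dot_sqr_line.
  have -> : s ^+ 2 * dot x x = - s * dot (p - w) x.
    by rewrite /s; field; rewrite gt_eqF.
  have : s * dot (p - w) x < 0 by rewrite pmulr_rlt0.
  lra.
exists (p - w); split => //.
(* Minimality is tested against [(1 - s) *: p]: first [s = 1], which shows that the optimal [s],
   namely [dot (p - w) p / dot p p], is admissible, then that value. Subtracting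
   [dot (p - w) (p - w)] yields [dot (p - w) w < 0]. *)
have : dot (p - w) p <= 0.
  have shrink s : 0 <= s <= 1 -> 0 <= - (2 * s * dot (p - w) p) + s ^+ 2 * dot p p.
    move=> s01; have /pmin : K ((1 - s) *: p) by apply: coneZ => //; lra.
    rewrite /f scalerBl scale1r addrAC -scaleNr dot_sqr_line sqrrN; lra.
  have pp1 : 2 * dot (p - w) p <= dot p p by have := shrink 1; lra.
  rewrite leNgt; apply/negP => pp.
  have pp0 : 0 < dot p p by lra.
  have /shrink : 0 <= dot (p - w) p / dot p p <= 1.
    by rewrite divr_ge0 ?(ltW pp) ?(ltW pp0)//= ler_pdivrMr// mul1r; lra.
  rewrite [X in 0 <= X](_ : _ = - (dot (p - w) p ^+ 2 / dot p p)); last first.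
    by field; rewrite gt_eqF.
  by rewrite oppr_ge0 leNgt divr_gt0// exprn_gt0.
move=> pp; have := v0; rewrite -dot_sqr_gt0 [X in 0 < X]dotDr dotNr; lra.
Qed.

End Cones.

(* [K1] splits into the reflection-invariant part where [reflection v y] is in
   [K], which contributes equally to both sides, and the rest, which the
   reflection brings closer to [w] and which contains a neighbourhood of the
   direction of [z]. *)
Lemma psi_reflection_lt (R : realType) (n : nat)
    (mu : {measure set (borelRn R n) -> \bar R}) (g : R -> R)
    (K : set 'rV[R]_n) (v w z : 'rV[R]_n) :
  uniform_sphere_measure mu -> closed K -> convex_cone K ->
  {in `[0, pi] &, forall x y, x < y -> g x < g y} ->
  v != 0 -> sphere w -> dot v w < 0 ->
  (forall y, K y -> dot v y < 0 -> K (reflection v y)) ->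
  K° z -> ~ K (reflection v z) ->
  psi mu g K (reflection v w) < psi mu g K w.
Proof.
move=> mu_unif cK coneK gincr v0 Sw vw Kv Kz nKz.
pose F (y : borelRn R n) := clamped_potential g (dot w y).
pose tau : borelRn R n -> borelRn R n := reflection v.
have mF : measurable_fun setT F.
  apply: (@measurableT_comp _ _ _ _ _ _ (clamped_potential g)).
    apply: nonincreasing_measurable => // s t.
    exact: (clamped_potential_nonincreasing gincr).
  by apply: continuous_borel_real; exact: dot_continuous.
have mtau : measurable_fun setT tau.
  by apply: continuous_borel; exact: reflection_continuous.
have mFtau : measurable_fun setT (F \o tau) by exact: measurableT_comp.
pose A : set (borelRn R n) := K `&` sphere (R:=R) (n:=n).
pose T : set (borelRn R n) := tau @^-1` K.
have mA : measurable A.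
  by apply: closed_borel; apply: closedI => //; exact: sphere_closed.
have cT : closed (T : set 'rV[R]_n).
  by apply: preimage_closed => // y _; exact: reflection_continuous.
have mT : measurable T by exact: closed_borel.
have mE : measurable (A `&` T) by exact: measurableI.
have mD : measurable (A `\` T) by exact: measurableD.
have int_bound (B : set (borelRn R n)) (f : borelRn R n -> 'rV[R]_n) :
    measurable B -> measurable_fun setT (fun y => clamped_potential g (dot w (f y))) ->
    mu.-integrable B (EFin \o (fun y => clamped_potential g (dot w (f y)))).
  move=> mB mf; apply: (bounded_borel_integrable mu_unif mB mf) => y.
  exact: (clamped_potential_bounded gincr).
have iF B : measurable B -> mu.-integrable B (EFin \o F).
  by move=> mB; exact: (int_bound _ id).
have iFtau B : measurable B -> mu.-integrable B (EFin \o (F \o tau)).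
  by move=> mB; exact: (int_bound _ tau).
have -> : psi mu g K w = \int[mu]_(y in A) F y.
  apply: eq_Rintegral => y /set_mem[_ Sy].
  by rewrite /F clamped_potentialE// sphere_dot_itv.
(* The reflection is self-adjoint, so it passes from [w] to the integration variable. *)
have -> : psi mu g K (reflection v w) = \int[mu]_(y in A) F (tau y).
  apply: eq_Rintegral => y /set_mem[_ Sy].
  rewrite /F /tau clamped_potentialE /rho ?dot_reflection//.
  by apply: sphere_dot_itv => //; exact: reflection_sphere.
have AE : A = (A `&` T) `|` (A `\` T) by rewrite setUIDK.
have disj : [disjoint A `&` T & A `\` T] by apply/disj_setPS => y [[_ ?] []].
rewrite AE !Rintegral_setU// -?AE//; [|exact: iF|exact: iFtau].
have -> : \int[mu]_(y in A `&` T) F (tau y) = \int[mu]_(y in A `&` T) F y.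
  apply: (Rintegral_reflection mu_unif) => //; last exact: iFtau.
  apply/seteqP; split => y /=.
    move=> [[Ky Sy] Ty]; rewrite /T /tau /= reflectionK// in Ty.
    split; last exact: Ky.
    by split => //; rewrite -(reflectionK v0 y); exact: reflection_sphere.
  move=> [[Ky Sy] Ty]; split; last by rewrite /T /tau /= reflectionK.
  by split => //; exact: reflection_sphere.
rewrite ltrD2l; apply: lt_Rintegral => //; [exact: iFtau|exact: iF| |].
  move=> y [[Ky Sy] nTy]; apply: (lt_clamped_potential gincr).
  - exact: sphere_dot_itv.
  - by apply: sphere_dot_itv => //; exact: reflection_sphere.
  (* On the hyperplane [y] would be fixed, and beyond it [Kv] would bring its image back into
     [K]. *)
  have vy : 0 < dot v y.
    rewrite lt_neqAle; apply/andP; split.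
      apply: contra_notN nTy => /eqP vy.
      by rewrite /T /tau /= /reflection -vy mulr0 mul0r scale0r subr0.
    by rewrite leNgt; apply: contra_notN nTy; exact: Kv.
  rewrite /tau /reflection !dot_linear (dotC w v) ltrDl oppr_gt0 nmulr_llt0//.
  by rewrite divr_gt0 ?mulr_gt0 ?dot_sqr_gt0.
pose r := (Num.sqrt (dot z z))^-1.
have z0 : z != 0.
  apply: contra_notN nKz => /eqP z0.
  rewrite /reflection z0 dot0r mulr0 mul0r scale0r subr0 -z0.
  exact: interior_subset.
have r0 : 0 < r by rewrite invr_gt0 sqrtr_gt0 dot_sqr_gt0.
(* An open set stable under positive scaling, so it contains the normalization [r *: z] of [z]. On
   the sphere it lies in [A] minus [T], and its remaining part is null. *)
pose U : set (borelRn R n) := K° `&` ~` T.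
have oU : open (U : set 'rV[R]_n).
  by apply: openI; [exact: open_interior|exact: closed_openC].
have mU : measurable U by exact: open_borel.
have muU : (0 < mu U)%E.
  apply: (uniform_sphere_open_gt0 mu_unif oU (x := r *: z)).
    split; first exact: cone_interiorZ.
    apply: contra_not nKz; rewrite /T /tau /= => /(coneZ coneK (t := r^-1)).
    have -> : reflection v (r *: z) = r *: reflection v z.
      rewrite /reflection dotZr scalerBr scalerA; congr (_ - _ *: _); ring.
    by rewrite scalerK ?lt0r_neq0//; apply; rewrite invr_ge0 ltW.
  rewrite /sphere /= !dot_linear mulrA -expr2 exprVn sqr_sqrtr ?dot_sqr_ge0//.
  by rewrite mulVf// gt_eqF// dot_sqr_gt0.
have S0 : mu (~` sphere (R:=R) (n:=n) : set (borelRn R n)) = 0%E by case: mu_unif => _ [].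
have mSc : measurable (~` sphere (R:=R) (n:=n) : set (borelRn R n)).
  by apply: measurableC; exact: sphere_borel.
rewrite (lt_le_trans muU)//.
apply: (@le_trans _ _ (mu ((A `\` T) `|` ~` sphere (R:=R) (n:=n)))).
  apply: le_measure; rewrite ?inE//; first exact: measurableU.
  move=> y [Ky nTy]; have [Sy|] := pselect (sphere y); last by right.
  by left; do 2?split => //; exact: interior_subset.
apply: le_trans (measureU2 _ mD mSc) _.
by rewrite [X in (_ + X)%E](S0 : mu _ = _) adde0.
Qed.

Theorem mainTheorem5 (R : realType) (n : nat)
    (mu : {measure set (borelRn R n) -> \bar R})
    (K : set 'rV[R]_n) (g : R -> R) :
  uniform_sphere_measure mu ->
  closed K -> convex_cone K -> proper_cone K -> interior K !=set0 ->
  {within `[0, pi], continuous g} ->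
  {in `[0, pi] &, forall x y, x < y -> g x < g y} ->
  (forall w, local_min_on_sphere (psi mu g K) w ->
     (dual_cone K `|` neg_set (dual_cone K)) w) /\
  (forall w, global_min_on_sphere (psi mu g K) w ->
     (K `&` dual_cone K) w).
Proof.
move=> mu_unif cK coneK [q [q0 Kq]] [z Kz] _ gincr.
have local_dual w : local_min_on_sphere (psi mu g K) w ->
    (dual_cone K `|` neg_set (dual_cone K)) w.
  move=> [Sw wmin]; apply: contrapT => /not_orP[nw nNw].
  have /existsNP[x1 /not_implyP[Kx1 /negP]] := nw; rewrite -ltNge => wx1.
  have /existsNP[x2 /not_implyP[Kx2 /negP]] := nNw.
  rewrite -ltNge dotNl oppr_lt0 => wx2.
  (* [dot w] is negative at [x1] and positive at [x2]: a nonnegative multiple of one of them, added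
     to [z], cancels [dot w z] and stays in the interior. *)
  have [v0 [Kv0 wv0]] : exists v0, K° v0 /\ dot w v0 = 0.
    have [wz|wz] := leP (dot w z) 0.
      exists ((- dot w z / dot w x2) *: x2 + z); split.
        apply: cone_interiorD => //; apply: coneZ => //.
        by rewrite divr_ge0 ?oppr_ge0// ltW.
      by rewrite !dot_linear divfK ?gt_eqF// addNr.
    exists ((- dot w z / dot w x1) *: x1 + z); split.
      apply: cone_interiorD => //; apply: coneZ => //.
      by rewrite mulr_le0 ?oppr_le0 ?ltW// invr_lt0.
    by rewrite !dot_linear divfK ?lt_eqF// addNr.
  have v0v0 : 0 < dot v0 v0.
    rewrite dot_sqr_gt0; apply: contraTneq (interior_dual_gt0 q0 Kq Kv0) => ->.
    by rewrite dot0r ltxx.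
  pose v (e : R) := v0 + e *: - w.
  have ww : dot w w = 1 := Sw.
  have vv e : dot (v e) (v e) = dot v0 v0 + e ^+ 2.
    rewrite dot_sqr_line !dot_linear ww (dotC v0) wv0; ring.
  have vw e : dot (v e) w = - e.
    by rewrite /v !dot_linear ww (dotC v0) wv0; ring.
  have reflE e : reflection (v e) w = w + (2 * e / dot (v e) (v e)) *: v e.
    by rewrite /reflection vw mulrN mulNr scaleNr opprK.
  (* The coefficient of [v e] in [reflE]: since [dot v0 v0] is positive it tends to [0], which
     brings the reflected point to [w]. *)
  have cvg_coef : (2 * e / (dot v0 v0 + e ^+ 2)) @[e --> (0 : R)^'+] --> (0 : R).
    apply: cvg_at_right_filter.
    have : (2 * e / (dot v0 v0 + e ^+ 2)) @[e --> (0 : R)] -->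
        2 * 0 / (dot v0 v0 + 0 ^+ 2).
      apply: cvgM; first by apply: cvgM; [exact: cvg_cst|exact: cvg_id].
      apply: cvgV; first by rewrite expr0n addr0 gt_eqF.
      by apply: cvgD; [exact: cvg_cst|apply: cvgM; exact: cvg_id].
    by rewrite mulr0 mul0r.
  have cvg_refl : reflection (v e) w @[e --> (0 : R)^'+] --> w.
    rewrite (_ : (fun e => _) = fun e => w + (2 * e / dot (v e) (v e)) *: v e);
      last by apply/funext => e; rewrite reflE.
    rewrite -[X in _ --> X]addr0 -(scale0r v0).
    apply: cvgD; first exact: cvg_cst.
    apply: cvgZ; last exact: cvg_line_at_right.
    by under eq_cvg do rewrite vv.
  have [e [e0 [Kve wmin_e]]] : exists e : R, 0 < e /\ K° (v e) /\
      (sphere (reflection (v e) w) ->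
       psi mu g K w <= psi mu g K (reflection (v e) w)).
    near (0 : R)^'+ => e; exists e; split; last split; near: e.
    - exact: nbhs_right_gt.
    - apply: (@cvg_line_at_right _ _ v0 (- w) K°).
      by move: (@open_interior _ K); rewrite openE; exact.
    - exact: (cvg_refl _ wmin).
  have ve0 : v e != 0 by rewrite -dot_sqr_gt0 vv addr_gt0// exprn_gt0.
  have := wmin_e (reflection_sphere ve0 Sw); rewrite leNgt => /negP; apply.
  apply: (psi_reflection_lt (z := v e)) => //.
  - by rewrite vw oppr_lt0.
  - move=> y Ky vy; rewrite /reflection -scaleNr; apply: coneD => //.
    apply: (coneZ coneK); last exact: interior_subset.
    by rewrite -mulNr divr_ge0 ?dot_sqr_ge0// -mulrN mulr_ge0// oppr_ge0 ltW.
  (* The interior point sent outside of [K] is [v e] itself: its image [- v e] has a negative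
     product with [q]. *)
  - rewrite reflection_self// => /Kq; rewrite dotNr oppr_ge0 leNgt.
    by rewrite (interior_dual_gt0 q0 Kq Kve).
split => // w [Sw wmin].
have Kw : K w.
  apply: contrapT => nKw.
  have [v [v0 vw Kv]] := cone_separation coneK cK (ex_intro _ _ (interior_subset Kz)) nKw.
  have := wmin _ (reflection_sphere v0 Sw); rewrite leNgt => /negP; apply.
  (* No point of [K] has a negative product with [v], so the stability condition is vacuous, and the
     image of [z] leaves [K]. *)
  apply: (psi_reflection_lt (z := z)) => //.
    by move=> y /Kv; rewrite leNgt => /negP.
  move=> /Kv; rewrite dot_reflectionl// oppr_ge0 leNgt.
  by rewrite (interior_dual_gt0 v0 Kv Kz).
(* A global minimum is local; if [- w] were in the dual cone, [w] in [K] would give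
   [0 <= dot (- w) w = -1]. *)
split => //; have [|//|/(_ _ Kw)] := local_dual w.
  by split => //; apply: (@filterE _ (nbhs w)) => x; exact: wmin.
by rewrite dotNl (Sw : dot w w = 1) oppr_ge0 leNgt ltr01.
Unshelve. all: by end_near. Qed.
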